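(* Let $N$ be even, $L=N/2$, and let $(g_\lambda,E_\lambda,M_\lambda)_{\lambda\in\Lambda}$ be a painless finite system of bands on $\mathbb{R}^N$, with band analysis operators $T_\lambda$, synthesis operator $S$, packing $P$, routers $R_\lambda$ and dual routers $\widetilde R_\lambda$ as defined in the context. Then for every $x\in\mathbb{R}^N$ and every $\lambda\in\Lambda$, $$T_\lambda x=F_{M_\lambda}^{-1}R_\lambda F_L P x,$$ and for every collection $\{c_\lambda\}_\lambda$ with $c_\lambda\in\mathbb{C}^{M_\lambda}$, $$S\bigl(\{c_\lambda\}_\lambda\bigr)=P^{-1}F_L^{-1}\sum_{\lambda\in\Lambda}\widetilde R_\lambda F_{M_\lambda}c_\lambda .$$
   Context: **Fourier matrices.** $F_n\in\mathbb{C}^{n\times n}$ has entries $[F_n]_{kj}=e^{-2\pi i kj/n}$, $0\le k,j\le n-1$, and $F_n^{-1}=\frac1n F_n^H$. **Bands.** $N$ is even and $\Lambda$ is a finite index set. Each band $\lambda\in\Lambda$ has a length $M_\lambda$, a real spectral window $g_\lambda=(g_{\lambda,k})_{0\le k<N}\in\mathbb{R}^N$, and a selection matrix $E_\lambda\in\mathbb{R}^{M_\lambda\times N}$ with entries in $\{0,1\}$, which places the bins $k$ with $g_{\lambda,k}\neq 0$ into distinct slots. That is, there is an injective map $\sigma_\lambda$ from $\{k: g_{\lambda,k}\ne0\}$ to $\{0,\dots,M_\lambda-1\}$ with $[E_\lambda]_{m,k}=1$ if $g_{\lambda,k}\neq0$ and $m=\sigma_\lambda(k)$, and $[E_\lambda]_{m,k}=0$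 otherwise. If $m=\sigma_\lambda(k)$, one says that entry $m$ of band $\lambda$ holds bin $k$. The system is painless: for every $\lambda\in\Lambda$ the map $\sigma_\lambda:\{k: g_{\lambda,k}\ne0\}\to\{0,\dots,M_\lambda-1\}$ is injective, and every bin is covered, meaning $a_k:=\sum_\lambda M_\lambda g_{\lambda,k}^2>0$ for $0\le k\le N/2$. **Analysis.** $T_\lambda:\mathbb{R}^N\to\mathbb{C}^{M_\lambda}$ is $T_\lambda x=F_{M_\lambda}^{-1}E_\lambda\,\mathrm{diag}(g_\lambda)F_Nx$. **Synthesis.** Let $h_{\lambda,k}=M_\lambda g_{\lambda,k}/a_k$ for $0\le k\le N/2$. $S:\prod_\lambda\mathbb{C}^{M_\lambda}\to\mathbb{R}^N$ is defined as follows. Form $Y_k=\sum_\lambda h_{\lambda,k}[E_\lambda^\top F_{M_\lambda}c_\lambda]_k$ for $0\le k\le N/2$, replace $Y_0$ and $Y_{N/2}$ by their real parts, set $Y_{N-k}=\overline{Y_k}$ for $1\le k<N/2$, and put $S(\{c_\lambda\}_\lambda)=F_N^{-1}Y$. **Packing.** $L=N/2$, and $P:\mathbb{R}^N\to\mathbb{C}^L$ is $(Px)_j=x_{2j}+i\,x_{2j+1}$, $0\le j<L$. Its inverse $P^{-1}$ unpacks each complex entry into two real ones. **Router.** Let $\omega_k=e^{-2\pi i k/N}$. $R_\lambda:\mathbb{C}^L\to\mathbb{C}^{M_\lambda}$ is the real-linear map $$[R_\lambda Z]_m=\tfrac12 g_{\lambda,k}\bigl[(1-i\omega_k)Z_{k\bmod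 L}+(1+i\omega_k)\overline{Z_{-k\bmod L}}\bigr]$$ if entry $m$ holds bin $k$, and $[R_\lambda Z]_m=0$ if entry $m$ holds no bin. **Dual router.** $\widetilde R_\lambda:\mathbb{C}^{M_\lambda}\to\mathbb{C}^L$ is the real-linear map defined as follows. For $u\in\mathbb{C}^{M_\lambda}$ put $X^{(\lambda)}_k=h_{\lambda,k}[E_\lambda^\top u]_k$ for $0\le k\le N/2$, and replace $X^{(\lambda)}_0$ and $X^{(\lambda)}_{N/2}$ by their real parts. Then $$[\widetilde R_\lambda u]_q=\tfrac12\bigl[(1+i\overline{\omega_q})X^{(\lambda)}_q+(1-i\overline{\omega_q})\overline{X^{(\lambda)}_{L-q}}\bigr],\qquad 0\le q<L.$$ *)

(* Defs.v *)
From mathcomp Require Import all_boot all_order all_algebra.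
From mathcomp Require Import reals trigo.
From mathcomp Require Import complex.

Set Implicit Arguments.
Unset Strict Implicit.
Unset Printing Implicit Defensive.

Import Order.TTheory GRing.Theory Num.Theory.
Local Open Scope ring_scope.
Local Open Scope complex_scope.

(* [ent v k] is v_k for a natural number index k < n, and 0 out of range.
   For even N > 0 every use below is in range, so the default plays no role. *)
Definition ent (T : nmodType) (n : nat) (v : 'cV[T]_n) (k : nat) : T :=
  if insub k is Some i then v i 0 else 0.

Lemma entE (T : nmodType) n (v : 'cV[T]_n) k (lt_kn : (k < n)%N) :
  ent v k = v (Ordinal lt_kn) 0.
Proof. by rewrite /ent insubT. Qed.

Lemma ent_ord (T : nmodType) n (v : 'cV[T]_n) (i : 'I_n) : ent v i = v i 0.
Proof. by rewrite /ent valK. Qed.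

Section Fourier.
Variable R : realType.

(* e^{i t} *)
Definition cis (t : R) : R[i] := cos t +i* sin t.

(* e^{-2 pi i k / n} *)
Definition omega (n k : nat) : R[i] := cis (- (2 * pi * k%:R / n%:R)).

Definition fourier (n : nat) : 'M[R[i]]_n := \matrix_(k, j) omega n (k * j).

Definition toC (m n : nat) (A : 'M[R]_(m, n)) : 'M[R[i]]_(m, n) :=
  map_mx (real_complex R) A.

End Fourier.

Section Bands.
Variables (R : realType) (N : nat) (Lambda : finType).

(* [slot l] is the map sigma_l, defined only on the bins where the window does
   not vanish, so that M_l may be smaller than N. *)
Record bands := Bands {
  blen : Lambda -> nat;
  window : Lambda -> 'rV[R]_N;
  slot : forall l : Lambda, {k : 'I_N | window l 0 k != 0} -> 'I_(blen l)
}.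

Variable B : bands.

(* entry m of band l holds bin k *)
Definition holds (l : Lambda) (m : 'I_(blen B l)) (k : 'I_N) : bool :=
  [exists k' : {k : 'I_N | window B l 0 k != 0},
     (val k' == k) && (slot k' == m)].

Definition selection (l : Lambda) : 'M[R]_(blen B l, N) :=
  \matrix_(m, k) (holds m k)%:R.

(* a_k *)
Definition framesum (k : 'I_N) : R :=
  \sum_l (blen B l)%:R * window B l 0 k ^+ 2.

Definition painless : Prop :=
  (forall l, injective (@slot B l)) /\
  (forall k : 'I_N, (k <= N./2)%N -> 0 < framesum k).

Definition analysis (l : Lambda) (x : 'cV[R]_N) : 'cV[R[i]]_(blen B l) :=
  invmx (fourier R (blen B l)) *m toC (selection l)
    *m diag_mx (toC (window B l)) *m fourier R N *m toC x.

(* h_{l,k}; only the bins k <= N/2 are ever used *)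
Definition dualwin (l : Lambda) (k : 'I_N) : R :=
  (blen B l)%:R * window B l 0 k / framesum k.

Definition dualband (l : Lambda) (u : 'cV[R[i]]_(blen B l)) : 'cV[R[i]]_N :=
  \col_k ((dualwin l k)%:C * ((toC (selection l))^T *m u) k 0).

(* replaces the bins 0 and N/2 by their real parts *)
Definition realends (Y : 'cV[R[i]]_N) : 'cV[R[i]]_N :=
  \col_k (if (k == 0 :> nat) || (k == N./2 :> nat) then (complex.Re (Y k 0))%:C
          else Y k 0).

(* overwrites the bins above N/2 by Hermitian symmetry *)
Definition hermext (Y : 'cV[R[i]]_N) : 'cV[R[i]]_N :=
  \col_(k < N) (if (k <= N./2)%N then Y k 0 else conjc (ent Y (N - k))).

(* S, as a complex vector: that its values are real is not built in. *)
Definition synthesis (c : forall l, 'cV[R[i]]_(blen B l)) : 'cV[R[i]]_N :=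
  invmx (fourier R N)
    *m hermext (realends (\sum_l dualband (fourier R (blen B l) *m c l))).

Definition pack (x : 'cV[R]_N) : 'cV[R[i]]_(N./2) :=
  \col_(j < N./2) (ent x j.*2 +i* ent x j.*2.+1).

Definition unpack (Z : 'cV[R[i]]_(N./2)) : 'cV[R]_N :=
  \col_(n < N) (if odd n then complex.Im (ent Z n./2)
               else complex.Re (ent Z n./2)).

Lemma unpackK : cancel unpack pack.
Proof.
move=> Z; apply/matrixP => j i; rewrite ord1 !mxE.
have lt1 : (j.*2.+1 < N)%N.
  have leN : (N./2.*2 <= N)%N by rewrite -{2}(odd_double_half N) leq_addl.
  by apply: leq_trans leN; rewrite -doubleS leq_double.
rewrite (entE _ (ltnW lt1)) (entE _ lt1) !mxE /= odd_double /=.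
by rewrite uphalf_double doubleK ent_ord; case: (Z j 0).
Qed.

Lemma packK : ~~ odd N -> cancel pack unpack.
Proof.
move=> evN x; apply/matrixP => n i; rewrite ord1 !mxE.
have lt2 : (n./2 < N./2)%N.
  rewrite -ltn_double (even_halfK evN) (leq_ltn_trans _ (ltn_ord n)) //.
  by rewrite -{2}(odd_double_half n) leq_addl.
rewrite (entE _ lt2) !mxE /=; have := odd_double_half n.
by case: (odd n) => /= en; rewrite ?add0n ?add1n in en; rewrite en ent_ord.
Qed.

Definition router (l : Lambda) (Z : 'cV[R[i]]_(N./2)) :
    'cV[R[i]]_(blen B l) :=
  \col_m (if [pick k | holds m k] is Some k then
      2^-1 * (window B l 0 k)%:C *
        ((1 - 'i%C * omega R N k) * ent Z (k %% N./2) +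
         (1 + 'i%C * omega R N k) * conjc (ent Z ((N./2 - k %% N./2) %% N./2)))
    else 0).

Definition dualrouter (l : Lambda) (u : 'cV[R[i]]_(blen B l)) :
    'cV[R[i]]_(N./2) :=
  let X := realends (dualband u) in
  \col_(q < N./2)
    (2^-1 * ((1 + 'i%C * conjc (omega R N q)) * ent X q +
             (1 - 'i%C * conjc (omega R N q)) * conjc (ent X (N./2 - q)))).

End Bands.

(* Main.v *)
Require Import Defs.
From mathcomp Require Import all_boot all_order all_algebra.
From mathcomp Require Import reals trigo.
From mathcomp Require Import complex.
From mathcomp Require Import ring lra.

Set Implicit Arguments.
Unset Strict Implicit.
Unset Printing Implicit Defensive.

Import Order.TTheory GRing.Theory Num.Theory.
Local Open Scope ring_scope.
Local Open Scope complex_scope.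

(** Splitting the samples of x by parity expresses both the length N spectrum of
    x and the length L spectrum of its packing through the spectra of the two
    halves; eliminating the latter gives [fourier N x = unmix (fourier L (pack x))]
    bin by bin, and the router is this identity read through the window and the
    selection. For the synthesis, [mix] inverts [unmix] on the bins k <= N/2 as
    soon as the bins 0 and N/2 are real, and the bins above N/2 agree because
    the spectrum of a real vector is Hermitian; it remains to cancel the
    invertible (Vandermonde) Fourier matrix. *)

Lemma big_ord_double (V : nmodType) (L : nat) (f : nat -> V) :
  \sum_(i < L.*2) f i = \sum_(j < L) (f j.*2 + f j.*2.+1).
Proof.
elim: L => [|L IH]; first by rewrite !big_ord0.
by rewrite doubleS !big_ord_recr /= IH addrA.
Qed.

(** * Roots of unity and invertibility of the Fourier matrix *)

Section Omega.
Variable R : realType.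

Lemma sqr_i : 'i%C * 'i%C = -1 :> R[i].
Proof. by simpc. Qed.

Lemma conj_i : conjc 'i%C = - 'i%C :> R[i].
Proof. by simpc. Qed.

Lemma conjcD (a b : R[i]) : conjc (a + b) = conjc a + conjc b.
Proof. exact: rmorphD. Qed.

Lemma conjcN (a : R[i]) : conjc (- a) = - conjc a.
Proof. exact: rmorphN. Qed.

Lemma conjcM (a b : R[i]) : conjc (a * b) = conjc a * conjc b.
Proof. exact: rmorphM. Qed.

Lemma cisD (s t : R) : cis (s + t) = cis s * cis t.
Proof. by rewrite /cis cosD sinD; simpc; rewrite [sin s * _ + _]addrC. Qed.

Lemma omega0 n : omega R n 0 = 1.
Proof. by rewrite /omega mulr0 mul0r oppr0 /cis cos0 sin0. Qed.

Lemma omegaD n a b : omega R n (a + b) = omega R n a * omega R n b.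
Proof. by rewrite /omega -cisD natrD mulrDr mulrDl opprD. Qed.

Lemma omegaX n a b : omega R n (a * b) = omega R n a ^+ b.
Proof.
by elim: b => [|b IH]; rewrite ?muln0 ?omega0 // mulnS omegaD IH exprS.
Qed.

Lemma omega_id n : (0 < n)%N -> omega R n n = 1.
Proof.
move=> n_gt0; rewrite /omega mulfK ?pnatr_eq0 -?lt0n //.
by rewrite /cis cosN sinN mulr_natl cos2pi sin2pi oppr0.
Qed.

Lemma omega_mod n k j : (0 < n)%N -> omega R n (k %% n * j) = omega R n (k * j).
Proof.
move=> n_gt0; rewrite {2}(divn_eq k n) mulnDl omegaD [(_ * n)%N]mulnC.
by rewrite -[(_ * _ * j)%N]mulnA [X in X * _]omegaX omega_id // expr1n mul1r.
Qed.

Lemma omega_conjM n k : conjc (omega R n k) * omega R n k = 1.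
Proof.
rewrite /omega /cis; simpc; set t := - _.
by rewrite -!expr2 cos2Dsin2 [cos t * sin t]mulrC subrr.
Qed.

Lemma omega_dvd n a : (0 < n)%N -> (n %| a)%N -> omega R n a = 1.
Proof. by move=> n0 /dvdnP[b ->]; rewrite mulnC omegaX omega_id ?expr1n. Qed.

Lemma omega_conj n a b : (0 < n)%N -> (n %| a + b)%N ->
  omega R n a = conjc (omega R n b).
Proof.
move=> n0 /(omega_dvd n0); rewrite omegaD => ab1.
by rewrite -[LHS]mulr1 -(omega_conjM n b) mulrCA ab1 mulr1.
Qed.

Lemma omega_double n k : omega R n.*2 k.*2 = omega R n k.
Proof.
by rewrite /omega -!muln2 !natrM mulrA -mulf_div divff ?mulr1 ?pnatr_eq0.
Qed.

Lemma omega_half n : (0 < n)%N -> omega R n.*2 n = -1.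
Proof.
move=> n0; rewrite /omega; have -> : 2 * pi * n%:R / n.*2%:R = pi :> R.
  rewrite -muln2 natrM; have : n%:R != 0 :> R by rewrite pnatr_eq0 -lt0n.
  by move=> ?; field.
by rewrite /cis cosN sinN cospi sinpi oppr0; simpc.
Qed.

(** The real part is [1 - 2 sin^2 (pi d / n)], and this sine is positive because the angle lies
    strictly between 0 and [pi]. *)
Lemma omega_neq1 n d : (0 < d < n)%N -> omega R n d != 1.
Proof.
case/andP=> d0 dn; have n0 : 0 < n%:R :> R by rewrite ltr0n (ltn_trans d0 dn).
apply/eqP => /(congr1 (@complex.Re R)) /=; rewrite cosN -!mulrA mulr_natl.
rewrite cos_mulr2n cos2sin2 => eq1.
have : 0 < sin (pi * (d%:R / n%:R)) :> R.
  apply: sin_gt0_pi; rewrite mulr_gt0 ?pi_gt0 ?divr_gt0 ?ltr0n ?(ltn_trans d0 dn) //=.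
  by rewrite gtr_pMr ?pi_gt0 // ltr_pdivrMr // mul1r ltr_nat.
move=> s0; have := exprn_gt0 2 s0; move: eq1; rewrite -mulr_natl; lra.
Qed.

Lemma fourier_unit n : fourier R n \in unitmx.
Proof.
have -> : fourier R n = Vandermonde n (\row_j omega R n j).
  by apply/matrixP => i j; rewrite !mxE mulnC omegaX.
rewrite unitmxE det_Vandermonde unitfE.
apply/prodf_neq0 => i _; apply/prodf_neq0 => j ij; rewrite !mxE subr_eq0.
apply/eqP => eq_ij; have /negP[] : omega R n (j - i) != 1.
  by apply: omega_neq1; rewrite subn_gt0 ij (leq_ltn_trans (leq_subr _ _)).
(* Equal nodes would have ratio 1, and the ratio is [omega R n (j - i)]. *)
apply/eqP; rewrite -[LHS]mul1r -(omega_conjM n i) -mulrA -omegaD.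
by rewrite subnKC 1?ltnW // eq_ij omega_conjM.
Qed.

Lemma mul_fourierE n (v : 'cV[R[i]]_n) (k : 'I_n) :
  (fourier R n *m v) k 0 = \sum_(j < n) omega R n (k * j) * v j 0.
Proof. by rewrite mxE; apply: eq_bigr => j _; rewrite mxE. Qed.

(** The samples are real, so conjugation only inverts the roots of unity. Stating the mirror
    relation by divisibility includes bin 0, which is its own mirror. *)
Lemma fourier_real_conj n (x : 'cV[R]_n) (k l : 'I_n) : (n %| k + l)%N ->
  (fourier R n *m toC x) k 0 = conjc ((fourier R n *m toC x) l 0).
Proof.
move=> dvd_kl; rewrite !mul_fourierE rmorph_sum /=; apply: eq_bigr => j _.
rewrite rmorphM !mxE /= oppr0; congr (_ * _).
by apply: omega_conj; rewrite -?mulnDl ?dvdn_mulr // (leq_ltn_trans _ (ltn_ord j)).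
Qed.

End Omega.

Lemma entD (V : nmodType) n (u v : 'cV[V]_n) k : ent (u + v) k = ent u k + ent v k.
Proof. by rewrite /ent; case: insub => [i|]; rewrite ?mxE ?addr0. Qed.

Lemma ent0 (V : nmodType) n k : ent (0 : 'cV[V]_n) k = 0.
Proof. by rewrite /ent; case: insub => [i|]; rewrite ?mxE. Qed.

(** * Spectra of real vectors and of their packings *)

Section Packing.
Variables (R : realType) (N : nat).
Hypothesis N_even : ~~ odd N.

Lemma half_gt0 (k : 'I_N) : (0 < N./2)%N.
Proof.
by rewrite -double_gt0 (even_halfK N_even) (leq_ltn_trans _ (ltn_ord k)).
Qed.

(* [router] without window and selection. *)
Definition unmix (Z : 'cV[R[i]]_(N./2)) (k : nat) : R[i] :=
  2^-1 * ((1 - 'i%C * omega R N k) * ent Z (k %% N./2) +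
          (1 + 'i%C * omega R N k) *
            conjc (ent Z ((N./2 - k %% N./2) %% N./2))).

(* [dualrouter] applied to an arbitrary spectrum X. *)
Definition mix (X : 'cV[R[i]]_N) : 'cV[R[i]]_(N./2) :=
  \col_(q < N./2)
    (2^-1 * ((1 + 'i%C * conjc (omega R N q)) * ent X q +
             (1 - 'i%C * conjc (omega R N q)) * conjc (ent X (N./2 - q)))).

(* With A and B the spectra of the even and odd samples, the packed spectrum Z
   satisfies Z_k = A_k + i B_k and conj Z_{-k} = A_k - i B_k, while the spectrum
   of x is A_k + omega_k B_k. *)
Lemma fourier_unmix_pack (x : 'cV[R]_N) (k : 'I_N) :
  (fourier R N *m toC x) k 0 = unmix (fourier R N./2 *m pack x) k.
Proof.
have L0 := half_gt0 k.
have -> : (fourier R N *m toC x) k 0 =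
    \sum_(j < N./2) omega R N./2 (k * j) *
      ((ent x j.*2)%:C + omega R N k * (ent x j.*2.+1)%:C).
  rewrite mul_fourierE.
  under eq_bigr => j _ do rewrite mxE -ent_ord.
  transitivity (\sum_(j < N./2.*2) omega R N (k * j) * (ent x j)%:C).
    by rewrite (even_halfK N_even).
  rewrite (big_ord_double _ (fun j => omega R N (k * j) * (ent x j)%:C)).
  apply: eq_bigr => j _; rewrite mulnS omegaD -doubleMr.
  by rewrite -(omega_double R N./2) (even_halfK N_even); ring.
have ltm i : (i %% N./2 < N./2)%N by rewrite ltn_mod.
rewrite /unmix !(entE _ (ltm _)) !mul_fourierE /= rmorph_sum /=.
rewrite !mulr_sumr -big_split mulr_sumr /=; apply: eq_bigr => j _.
rewrite omega_mod // mxE conjcM.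
have -> : conjc (omega R N./2 ((N./2 - k %% N./2) %% N./2 * j))
    = omega R N./2 (k * j).
  rewrite -(omega_mod R k) //; apply/esym/omega_conj => //.
  rewrite -mulnDl dvdn_mulr // /dvdn modnDmr subnKC ?modnn //.
  by rewrite ltnW ?ltn_mod.
(* Termwise, [(1 - i w)(a + i b) + (1 + i w)(a - i b) = 2 (a + w b)]. *)
rewrite [ent x _ +i* _]complexE conjcD conjcM conj_i !conjc_real /=.
by have i2 := @sqr_i R; field: i2.
Qed.

Lemma mixD : {morph mix : X Y / X + Y}.
Proof.
by move=> X Y; apply/matrixP => q i; rewrite !mxE !entD conjcD; ring.
Qed.

Lemma mix0 : mix 0 = 0.
Proof.
by apply/matrixP => q i; rewrite !mxE !ent0 conjc0 !mulr0 addr0 mulr0.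
Qed.

Lemma realendsD : {morph @realends R N : X Y / X + Y}.
Proof.
by move=> X Y; apply/matrixP => q i; rewrite !mxE; case: ifP => // _; rewrite raddfD rmorphD.
Qed.

Lemma realends0 : realends (0 : 'cV[R[i]]_N) = 0.
Proof. by apply/matrixP => q i; rewrite !mxE; case: ifP. Qed.

Lemma realends_real (V : 'cV[R[i]]_N) (k : 'I_N) :
  (k == 0 :> nat) || (k == N./2 :> nat) ->
  conjc (ent (realends V) k) = ent (realends V) k.
Proof. by rewrite ent_ord mxE => ->; rewrite conjc_real. Qed.

(** For [0 < k < N./2] this inverts a 2 by 2 system coupling bin [k] with the conjugate of bin
    [N./2 - k]. Bins 0 and [N./2] share entry 0 of the packed spectrum, which has room for both only
    because [realends] makes them real. *)
Lemma unmix_mix (V : 'cV[R[i]]_N) (k : 'I_N) : (k <= N./2)%N ->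
  unmix (mix (realends V)) k = realends V k 0.
Proof.
move=> le_kL; have L0 := half_gt0 k.
have N0 : (0 < N)%N := leq_ltn_trans (leq0n k) (ltn_ord k).
have ltLN : (N./2 < N)%N.
  by rewrite -{2}(even_halfK N_even) -addnn -{1}[N./2]addn0 ltn_add2l.
have real0 := realends_real V (k := Ordinal N0) isT.
have := realends_real V (k := Ordinal ltLN); rewrite /= eqxx orbT => /(_ isT).
move=> realL; have i2 := @sqr_i R.
have omL : omega R N N./2 = -1 by rewrite -{1}(even_halfK N_even) omega_half.
have mixE (q : nat) (ltq : (q < N./2)%N) : ent (mix (realends V)) q =
    2^-1 * ((1 + 'i%C * conjc (omega R N q)) * ent (realends V) q +
    (1 - 'i%C * conjc (omega R N q)) * conjc (ent (realends V) (N./2 - q))).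
  by rewrite (entE _ ltq) mxE.
have conj_half : conjc (2^-1) = 2^-1 :> R[i] by rewrite conjc_inv conjc_nat.
rewrite -ent_ord /unmix; have [lt_kL | ge_kL] := ltnP k N./2; last first.
  have -> : k = N./2 :> nat by apply/eqP; rewrite eqn_leq le_kL.
  rewrite modnn subn0 modnn mixE // subn0 omega0 omL realL.
  rewrite !(conjcM, conjcD, conjcN) !conjc1 conj_half conj_i real0 realL.
  by field: i2.
have [k0 | k_gt0] := posnP k.
  rewrite k0 mod0n subn0 modnn mixE // subn0 omega0 realL.
  rewrite !(conjcM, conjcD, conjcN) !conjc1 conj_half conj_i real0 realL.
  by field: i2.
rewrite modn_small // modn_small ?ltn_subrL ?k_gt0 ?L0 //.
rewrite !mixE ?ltn_subrL ?k_gt0 ?L0 // subKn //.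
set w := omega R N k; have ww : conjc w * w = 1 := omega_conjM R N k.
have -> : conjc (omega R N (N./2 - k)) = - w.
  have : omega R N (N./2 - k) * w = -1 by rewrite -omegaD subnK // omL.
  move=> /(congr1 (fun z => conjc z * w)); rewrite conjcM -mulrA ww mulr1 => ->.
  by rewrite conjcN conjc1 mulN1r.
rewrite !(conjcM, conjcD, conjcN) !conjc1 conj_half conj_i !conjcK.
(* By [ww], bin [k] gets coefficient [(2 + 2 conj(w) w) / 4 = 1] and its partner
   [(2 - 2 conj(w) w) / 4 = 0]. *)
by field: i2 ww.
Qed.

End Packing.

(** * Routers, dual routers and synthesis *)

Section Bands.
Variables (R : realType) (N : nat) (Lambda : finType) (B : bands R N Lambda).
Hypotheses (N_even : ~~ odd N) (slot_inj : forall l, injective (@slot _ _ _ B l)).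

Lemma holds_inj l (m : 'I_(blen B l)) k k' : holds m k -> holds m k' -> k = k'.
Proof.
move=> /existsP[a /andP[/eqP <- /eqP am]] /existsP[b /andP[/eqP <- /eqP bm]].
by congr val; apply: slot_inj; rewrite am bm.
Qed.

(** Injectivity of the slots leaves at most one nonzero term in each row of the selection, namely
    the bin that [pick] finds. *)
Lemma router_select l (x : 'cV[R]_N) :
  toC (selection B l) *m diag_mx (toC (window B l)) *m fourier R N *m toC x
  = router B l (fourier R N./2 *m pack x).
Proof.
rewrite -[LHS]mulmxA; apply/matrixP => m i; rewrite ord1 mxE [RHS]mxE.
under eq_bigr => k _.
  rewrite (fourier_unmix_pack N_even) mul_mx_diag !mxE.
  over.
case: pickP => [k mk | no_k]; last first.
  by rewrite big1 // => k _; rewrite no_k !mul0r.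
rewrite (bigD1 k) //= mk mul1r big1 ?addr0 => [|k' ne_k'k].
  by rewrite /unmix mulrCA mulrA.
case mk': (holds m k'); last by rewrite !mul0r.
by rewrite (holds_inj mk' mk) eqxx in ne_k'k.
Qed.

(** Additivity suffices here; [realends] and [mix] involve conjugates or real parts and are only
    real-linear. *)
Lemma sum_dualrouter (u : forall l, 'cV[R[i]]_(blen B l)) :
  \sum_l dualrouter (u l) = mix (realends (\sum_l dualband (u l))).
Proof.
rewrite (big_morph _ (@realendsD R N) (@realends0 R N)).
by rewrite (big_morph _ (@mixD R N) (@mix0 R N)).
Qed.

(** This exhibits the Hermitian extension as the spectrum of a real vector, so it also shows that
    [synthesis] has real values. *)
Lemma fourier_unpack_mix (V : 'cV[R[i]]_N) :
  fourier R N *m toC (unpack (invmx (fourier R N./2) *m mix (realends V)))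
  = hermext (realends V).
Proof.
set x := unpack _.
have lowE (k : 'I_N) : (k <= N./2)%N ->
    (fourier R N *m toC x) k 0 = realends V k 0.
  move=> le_kL; rewrite (fourier_unmix_pack N_even) unpackK mulKVmx ?fourier_unit //.
  exact: unmix_mix.
apply/matrixP => k i; rewrite ord1 [RHS]mxE; case: leqP => [/lowE // | gt_kL].
(* Positivity of [k] keeps [N - k] below [N], so [ent] in [hermext] reads a true entry and not its
   default 0. *)
have k_gt0 : (0 < k)%N := leq_ltn_trans (leq0n _) gt_kL.
have lt_lN : (N - k < N)%N by rewrite ltn_subrL k_gt0 (leq_ltn_trans _ (ltn_ord k)).
rewrite (entE _ lt_lN) -lowE; last first.
  by rewrite /= leq_subLR -{1}(even_halfK N_even) -addnn leq_add2r ltnW.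
by apply: fourier_real_conj; rewrite /= subnKC // ltnW.
Qed.

End Bands.

Theorem mainTheorem2 (R : realType) (N : nat) (N_gt0 : (0 < N)%N)
    (N_even : ~~ odd N) (Lambda : finType) (B : bands R N Lambda)
    (B_painless : painless B) :
  (forall (x : 'cV[R]_N) (l : Lambda),
     analysis B l x
     = invmx (fourier R (blen B l))
         *m router B l (fourier R N./2 *m pack x)) /\
  (forall c : (forall l : Lambda, 'cV[R[i]]_(blen B l)),
     synthesis c
     = toC (unpack (invmx (fourier R N./2)
              *m \sum_l dualrouter (fourier R (blen B l) *m c l)))).

Proof.
case: B_painless => slot_inj _; split=> [x l | c].
  by rewrite -(router_select N_even slot_inj) /analysis !mulmxA.
rewrite /synthesis sum_dualrouter -(fourier_unpack_mix N_even).
by rewrite mulKmx ?fourier_unit.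
Qed.
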